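(* Let $(\mathfrak{a}, \triangleleft, \triangleright, [~,~]_\mathfrak{a})$ be a post-Leibniz algebra, and set $[u , v]_\star = u \triangleleft v + u \triangleright v + [u, v]_\mathfrak{a}$ for $u,v\in\mathfrak{a}$. Then $(\mathfrak{a}, [~,~]_\star)$ is a Leibniz algebra.
   Context: Vector spaces are over a field $\mathbf{k}$ of characteristic $0$. A (left) Leibniz algebra is a vector space $\mathfrak{g}$ with a bilinear bracket $[~,~]_\mathfrak{g}$ satisfying $[x,[y,z]_\mathfrak{g}]_\mathfrak{g} = [[x,y]_\mathfrak{g},z]_\mathfrak{g} + [y,[x,z]_\mathfrak{g}]_\mathfrak{g}$ for all $x,y,z$. A post-Leibniz algebra is a vector space $\mathfrak{a}$ with three bilinear operations $\triangleleft,\triangleright,[~,~]_\mathfrak{a}:\mathfrak{a}\otimes\mathfrak{a}\to\mathfrak{a}$ satisfying for $u,v,w\in\mathfrak{a}$, with $[u,v]_\star = u\triangleleft v+u\triangleright v+[u,v]_\mathfrak{a}$: (1) $u \triangleleft [v , w]_\star = (u \triangleleft v) \triangleleft w + v \triangleright (u \triangleleft w)$; (2) $u \triangleright (v \triangleleft w) = (u \triangleright v) \triangleleft w + v \triangleleft [u , w]_\star$; (3) $u \triangleright (v \triangleright w) = [u , v]_\star \triangleright w + v \triangleright (u \triangleright w)$; (4) $u \triangleright [v,w]_\mathfrak{a} = [u \triangleright v, w]_\mathfrak{a} + [ v, u \triangleright w]_\mathfrak{a}$; (5) $[u, v \triangleright w]_\mathfrak{a} = [ u \triangleleft v, w]_\mathfrak{a}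 + v \triangleright [u, w]_\mathfrak{a}$; (6) $[u, v \triangleleft w]_\mathfrak{a} = [u,v]_\mathfrak{a} \triangleleft w + [v, u \triangleleft w]_\mathfrak{a}$; (7) $[u, [v,w]_\mathfrak{a}]_\mathfrak{a} = [[u,v]_\mathfrak{a}, w]_\mathfrak{a} + [v, [u, w]_\mathfrak{a}]_\mathfrak{a}$. *)

(* Defs.v *)
From mathcomp Require Import all_boot all_algebra.
Set Implicit Arguments.
Unset Strict Implicit.
Unset Printing Implicit Defensive.
Import GRing.Theory.
Local Open Scope ring_scope.

Definition bilinear_op (k : fieldType) (V : lmodType k) (f : V -> V -> V)
    : Prop :=
  bilinear_for *:%R *:%R f.

Record is_leibniz_algebra (k : fieldType) (g : lmodType k)
    (br : g -> g -> g) : Prop := IsLeibnizAlgebra {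
  leibniz_bilinear : bilinear_op br;
  leibniz_identity : forall x y z,
    br x (br y z) = br (br x y) z + br y (br x z)
}.

Definition star_bracket (k : fieldType) (a : lmodType k)
    (tl tr br : a -> a -> a) (u v : a) : a :=
  tl u v + tr u v + br u v.

(* [tl], [tr], [br] stand for the left triangle, the right triangle and the
   bracket, in this order. *)
Record is_post_leibniz_algebra (k : fieldType) (a : lmodType k)
    (tl tr br : a -> a -> a) : Prop := IsPostLeibnizAlgebra {
  post_leibniz_tl_bilinear : bilinear_op tl;
  post_leibniz_tr_bilinear : bilinear_op tr;
  post_leibniz_br_bilinear : bilinear_op br;
  post_leibniz_tl_star : forall u v w,
    tl u (star_bracket tl tr br v w) = tl (tl u v) w + tr v (tl u w);
  post_leibniz_tr_tl : forall u v w,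
    tr u (tl v w) = tl (tr u v) w + tl v (star_bracket tl tr br u w);
  post_leibniz_tr_tr : forall u v w,
    tr u (tr v w) = tr (star_bracket tl tr br u v) w + tr v (tr u w);
  post_leibniz_tr_br : forall u v w,
    tr u (br v w) = br (tr u v) w + br v (tr u w);
  post_leibniz_br_tr : forall u v w,
    br u (tr v w) = br (tl u v) w + tr v (br u w);
  post_leibniz_br_tl : forall u v w,
    br u (tl v w) = tl (br u v) w + br v (tl u w);
  post_leibniz_br_br : forall u v w,
    br u (br v w) = br (br u v) w + br v (br u w)
}.

(* Main.v *)
Require Import Defs.
From mathcomp Require Import all_boot all_algebra ssrAC.
Import GRing.Theory.
Local Open Scope ring_scope.

(** Each of the seven post-Leibniz axioms is one piece of the Leibniz identity
    of the star bracket.  Since [u * (v * w)], written with [*] for the star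
    bracket, is

      [tl u (v * w) + tr u (v * w) + br u (v * w)],

    expanding only the last two terms, in their second argument, gives exactly
    the seven left-hand sides of the axioms.  The seven right-hand sides consist
    of fourteen terms: the seven in which [w] is the right argument of the outer
    operation and [u], [v] are paired add up to [(u * v) * w], and the seven in
    which [u], [w] are paired add up to [v * (u * w)].  Hence star brackets are
    left unexpanded wherever an axiom mentions them: these are
    [tl u (v * w)], [tr (u * v) w] and [tl v (u * w)]. *)

Lemma bilinear_opDl (k : fieldType) (V : lmodType k) (f : V -> V -> V) :
  bilinear_op f -> forall x y z, f (x + y) z = f x z + f y z.
Proof. by move=> [fl _] x y z; have := fl z 1 x y; rewrite /= !scale1r. Qed.

Lemma bilinear_opDr (k : fieldType) (V : lmodType k) (f : V -> V -> V) :
  bilinear_op f -> forall x y z, f x (y + z) = f x y + f x z.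
Proof. by move=> [_ fr] x y z; have := fr x 1 y z; rewrite /= !scale1r. Qed.

Lemma bilinear_op_add (k : fieldType) (V : lmodType k) (f g : V -> V -> V) :
  bilinear_op f -> bilinear_op g -> bilinear_op (fun u v => f u v + g u v).
Proof.
move=> [fl fr] [gl gr]; split=> [z c x y | z c x y] /=.
- have /= -> := fl z c x y; have /= -> := gl z c x y.
  by rewrite scalerDr addrACA.
- have /= -> := fr z c x y; have /= -> := gr z c x y.
  by rewrite scalerDr addrACA.
Qed.

Theorem proposition6p3 (k : fieldType) (char_k : [pchar k] =i pred0)
    (a : lmodType k) (tl tr br : a -> a -> a)
    (post_a : is_post_leibniz_algebra tl tr br) :
  is_leibniz_algebra (star_bracket tl tr br).
Proof.
case: post_a => tlB trB brB tl_star tr_tl tr_tr tr_br br_tr br_tl br_br.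
split; first exact: (bilinear_op_add _ _ _ _ (bilinear_op_add _ _ _ _ tlB trB) brB).
move=> u v w.
have starE x y : star_bracket tl tr br x y = tl x y + tr x y + br x y by [].
have tlDl := bilinear_opDl _ _ _ tlB.
have trDr := bilinear_opDr _ _ _ trB.
have brDl := bilinear_opDl _ _ _ brB.
have brDr := bilinear_opDr _ _ _ brB.
have lhsE : star_bracket tl tr br u (star_bracket tl tr br v w) =
    tl u (star_bracket tl tr br v w)
    + (tr u (tl v w) + tr u (tr v w) + tr u (br v w))
    + (br u (tl v w) + br u (tr v w) + br u (br v w)).
  by rewrite [LHS]starE; congr (_ + _ + _); rewrite starE ?trDr ?brDr.
rewrite (tl_star u v w) (tr_tl u v w) (tr_tr u v w) (tr_br u v w) in lhsE.
rewrite (br_tl u v w) (br_tr u v w) (br_br u v w) in lhsE.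
have uv_pairedE :
    star_bracket tl tr br (star_bracket tl tr br u v) w =
    (tl (tl u v) w + tl (tr u v) w + tl (br u v) w)
    + tr (star_bracket tl tr br u v) w
    + (br (tl u v) w + br (tr u v) w + br (br u v) w).
  by rewrite [LHS]starE; congr (_ + _ + _); rewrite starE ?tlDl ?brDl.
have uw_pairedE :
    star_bracket tl tr br v (star_bracket tl tr br u w) =
    tl v (star_bracket tl tr br u w)
    + (tr v (tl u w) + tr v (tr u w) + tr v (br u w))
    + (br v (tl u w) + br v (tr u w) + br v (br u w)).
  by rewrite [LHS]starE; congr (_ + _ + _); rewrite starE ?trDr ?brDr.
rewrite uv_pairedE uw_pairedE lhsE !addrA.
(* Odd positions hold the terms pairing u with v, even positions those pairing
   u with w. *)
by rewrite [LHS](ACl (1*3*9*5*11*7*13*4*2*6*12*10*8*14))%AC.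
Qed.
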